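(* Let $G$ and $H$ be two graphs of order $n$. The following statements are equivalent: (i) $G$ and $H$ are generalized cospectral; (ii) $n_\beta(G) = n_\beta(H)$ for every integer $k \ge 1$ and every binary vector $\beta \in \{0,1\}^k$; (iii) $n_\beta(G)= n_\beta(H)$ for every $\beta\in\{\mathbf{1}_k : 1\le k\le n\}\cup\{\mathbf{0}_k : 1\le k\le n\}$.
   Context: All graphs are finite, simple and undirected. $A(G)$ denotes the adjacency matrix of $G$ and $\overline{G}$ its complement. Two graphs $G$ and $H$ are generalized cospectral if $A(G),A(H)$ have the same multiset of eigenvalues and $A(\overline{G}),A(\overline{H})$ have the same multiset of eigenvalues. For $\beta=(\beta_1,\dots,\beta_k)\in\{0,1\}^k$, a $\beta$-closed walk in $G$ is a sequence of vertices $v_1,\dots,v_{k+1}$ with $v_{k+1}=v_1$ such that for each $i\in\{1,\dots,k\}$, $v_iv_{i+1}$ is an edge of $G$ if $\beta_i=1$, and an edge of $\overline{G}$ if $\beta_i=0$. $n_\beta(G)$ denotes the total number of $\beta$-closed walks in $G$; equivalently $n_\beta(G)=\operatorname{tr}\left(\prod_{i=1}^k M_{\beta_i}(G)\right)$ (product in the order $i=1,\dots,k$), where $M_1(G)=A(G)$ and $M_0(G)=A(\overline{G})$. $\mathbf{1}_k$ and $\mathbf{0}_k$ are the all-ones and all-zeros vectors of length $k$. *)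

(* Defs.v *)
From HB Require Import structures.
From mathcomp Require Import all_boot all_order all_algebra.
Set Implicit Arguments.
Unset Strict Implicit.
Unset Printing Implicit Defensive.
Import Order.TTheory GRing.Theory Num.Theory.
Local Open Scope ring_scope.

Record sgraph := SGraph {
  vertex :> finType;
  edge : rel vertex;
  edge_sym : symmetric edge;
  edge_irr : irreflexive edge }.

Definition co_edge (G : sgraph) : rel G := [rel x y | (x != y) && ~~ edge x y].

Lemma co_edge_sym (G : sgraph) : symmetric (@co_edge G).
Proof. by move=> x y; rewrite /co_edge /= eq_sym edge_sym. Qed.

Lemma co_edge_irr (G : sgraph) : irreflexive (@co_edge G).
Proof. by move=> x; rewrite /co_edge /= eqxx. Qed.

Definition compl (G : sgraph) : sgraph :=
  SGraph (@co_edge_sym G) (@co_edge_irr G).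

(* Rows and columns follow the canonical enumeration of the vertices. *)
Definition adjmx (C : numClosedFieldType) (G : sgraph) : 'M[C]_#|G| :=
  \matrix_(i, j) (edge (enum_val i) (enum_val j))%:R.

(* The roots of the characteristic polynomial, repeated according to their
   algebraic multiplicity. Only the multiset is canonical, so spectra are to be
   compared with perm_eq. *)
Definition spectrum (C : numClosedFieldType) (n : nat) (A : 'M[C]_n) : seq C :=
  sval (closed_field_poly_normal (char_poly A)).

Lemma spectrumE (C : numClosedFieldType) (n : nat) (A : 'M[C]_n) :
  char_poly A = \prod_(a <- spectrum A) ('X - a%:P).
Proof.
rewrite /spectrum; case: closed_field_poly_normal => s /= {1}->.
by rewrite (monicP (char_poly_monic A)) scale1r.
Qed.

Lemma mem_spectrum (C : numClosedFieldType) (n : nat) (A : 'M[C]_n) :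
  spectrum A =i eigenvalue A.
Proof.
move=> a; rewrite [RHS]eigenvalue_root_char.
by rewrite spectrumE root_prod_XsubC.
Qed.

Definition cospectral (C : numClosedFieldType) (G H : sgraph) : Prop :=
  perm_eq (spectrum (adjmx C G)) (spectrum (adjmx C H)).

Definition gen_cospectral (C : numClosedFieldType) (G H : sgraph) : Prop :=
  cospectral C G H /\ cospectral C (compl G) (compl H).

Definition step (G : sgraph) (b : bool) : rel G :=
  if b then @edge G else @edge (compl G).

(* A walk v_1, ..., v_{k+1} is stored as w 0, ..., w k. For i : 'I_k,
   [widen_ord (leqnSn k) i] is i and [lift ord0 i] is i + 1 in 'I_k.+1. *)
Definition closed_walk (G : sgraph) (k : nat) (beta : k.-tuple bool)
    (w : {ffun 'I_k.+1 -> G}) : bool :=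
  (w ord_max == w ord0) &&
  [forall i : 'I_k,
     step (tnth beta i) (w (widen_ord (leqnSn k) i)) (w (lift ord0 i))].

Definition nwalk (G : sgraph) (k : nat) (beta : k.-tuple bool) : nat :=
  #|[set w : {ffun 'I_k.+1 -> G} | closed_walk beta w]|.

Definition ones (k : nat) : k.-tuple bool := [tuple of nseq k true].
Definition zeros (k : nat) : k.-tuple bool := [tuple of nseq k false].

(* Main.v *)
(* Closed walks are counted by traces of words in A and J - I - A, where J is the
   all-ones matrix. By Newton's identities the traces of the first n powers
   determine a spectrum, so (iii) implies (i). For (i) => (ii), set
   W_k = 1^T A^k 1 = tr (J A^k). Since J X J = tr (J X) J, expanding the letters
   J - I - A reduces the trace of every word to the numbers tr (A^k) and W_k, and
   the W_k are recovered inductively because tr ((J - I - A)^(k+1)) involves W_k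
   with coefficient (-1)^k (k+1) and otherwise only tr (A^i) and the W_j, j < k. *)

Require Import Defs.
From mathcomp Require Import all_boot all_order all_algebra.
From mathcomp Require Import spectral ring.
Set Implicit Arguments.
Unset Strict Implicit.
Unset Printing Implicit Defensive.
Import Order.TTheory GRing.Theory Num.Theory.
Local Open Scope ring_scope.

(** * Power sums and Newton's identities *)

(* Newton's identities in generating form: X^N p'/p is the sum of the power sums
   of the roots times X^(N-1-i), up to a remainder of degree below that of p. *)
Lemma deriv_prod_XsubC (F : fieldType) (N : nat) (s : seq F) :
  let p := \prod_(a <- s) ('X - a%:P) in
  exists2 r : {poly F}, (size r <= size s)%N &
    'X^N * p^`() =
      p * (\sum_(i < N) (\sum_(a <- s) a ^+ i) *: 'X^(N.-1 - i)) + r.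
Proof.
elim: s => [|a s [r size_r IHs]] /=.
  exists 0; first by rewrite size_poly0.
  rewrite big_nil derivC mulr0 addr0 mul1r big1 // => i _.
  by rewrite big_nil scale0r.
set p := \prod_(b <- s) _ in IHs *.
(* Dividing X^N by X - a leaves the remainder a^N, and the quotient carries the powers of the new
   root. *)
have geo : 'X^N = ('X - a%:P) * (\sum_(i < N) a ^+ i *: 'X^(N.-1 - i))
                  + (a ^+ N)%:P.
  rewrite polyC_exp; apply/eqP; rewrite -subr_eq subrXX; apply/eqP.
  congr (_ * _); apply: eq_bigr => i _.
  by rewrite -polyC_exp mulrC mul_polyC.
exists (a ^+ N *: p + ('X - a%:P) * r).
  rewrite (leq_trans (size_polyD _ _)) // geq_max.
  rewrite (leq_trans (size_scale_leq _ _)) ?size_prod_XsubC //=.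
  by rewrite (leq_trans (size_polyMleq _ _)) // size_XsubC.
rewrite big_cons -/p derivM derivXsubC mul1r mulrDr mulrCA IHs {1}geo.
under [in RHS]eq_bigr do rewrite big_cons scalerDl.
rewrite big_split /= -mul_polyC.
by ring.
Qed.

(** Both monic products satisfy Newton's generating identity with the same power sums, so their
    difference satisfies it up to a remainder of low degree. In characteristic 0 its leading
    coefficient must then vanish. *)
Lemma perm_eq_power_sums (F : numFieldType) (s t : seq F) :
  size s = size t ->
  (forall k, (1 <= k <= size s)%N ->
     \sum_(a <- s) a ^+ k = \sum_(a <- t) a ^+ k) ->
  perm_eq s t.
Proof.
move=> size_st eq_st; set n := size s.
apply: prod_XsubC_eq; apply/eqP; rewrite -subr_eq0.
(* Taking [n.+1] terms involves exactly the power sums of exponents 0 to n, and both remainders have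
   degree below n. *)
have [r size_r] := deriv_prod_XsubC n.+1 s.
have [r' size_r'] := deriv_prod_XsubC n.+1 t.
have size_p := size_prod_XsubC s id; have size_q := size_prod_XsubC t id.
have p_monic := monic_prod_XsubC s xpredT id.
have q_monic := monic_prod_XsubC t xpredT id.
move: size_p size_q p_monic q_monic.
set p := \prod_(a <- s) _; set q := \prod_(a <- t) _.
move=> size_p size_q /monicP p_monic /monicP q_monic.
(* Exponent 0 lies outside the hypothesis; there the power sum is the number of roots. *)
have -> : \sum_(i < n.+1) (\sum_(a <- t) a ^+ i) *: 'X^(n - i) =
          \sum_(i < n.+1) (\sum_(a <- s) a ^+ i) *: 'X^(n - i).
  apply: eq_bigr => -[[|i] lti] _ /=; last by rewrite -eq_st ?lti.
  by rewrite !big_const_seq !count_predT size_st.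
rewrite big_ord_recl /= subn0.
set T := \sum_(i < n) _ => defq defp.
have p0 : \sum_(a <- s) a ^+ @ord0 n = n%:R.
  by rewrite big_const_seq count_predT iter_addr_0.
rewrite {}p0 in defp defq *.
(* If d = p - q had degree m < n, comparing coefficients of X^(n+m) below would
   give m * d_m = n * d_m. *)
set d := p - q; apply: contraT => d_neq0; set m := (size d).-1.
have size_d : size d = m.+1 by rewrite prednK // lt0n size_poly_eq0.
have lt_mn : (m < n)%N.
  rewrite -size_d; apply/leq_sizeP => j; rewrite leq_eqVlt => /predU1P[<-|ltnj].
    rewrite coefB; move: p_monic q_monic.
    by rewrite /lead_coef size_p size_q -size_st => -> ->; rewrite subrr.
  by rewrite coefB !nth_default ?subr0 // ?size_p ?size_q -?size_st.
have size_T : (size T <= n)%N.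
  apply: (leq_trans (size_sum _ _ _)); apply/bigmax_leqP => i _.
  rewrite (leq_trans (size_scale_leq _ _)) // size_polyXn /bump leq0n /= add1n.
  by rewrite subnSK // leq_subr.
have {defp defq} : 'X^(n.+1) * d^`() = d * (n%:R *: 'X^n + T) + (r - r').
  by rewrite /d derivB mulrBr defp defq; ring.
move/(congr1 (fun P : {poly F} => P`_(n + m))).
rewrite coefXnM !coefD coefN mulrDr coefD -scalerAr coefZ coefMXn.
rewrite [(n + m < n)%N]ltnNge leq_addr /= addKn.
rewrite [(d * T)`_ _]nth_default; last first.
  rewrite (leq_trans (size_polyMleq _ _)) // size_d addSn /= addnC leq_add2r.
  exact: size_T.
rewrite [r`_ _]nth_default; last exact: leq_trans size_r (leq_addr _ _).
rewrite [r'`_ _]nth_default; last first.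
  by rewrite (leq_trans size_r') // -size_st leq_addr.
rewrite !addr0 subr0 addr0.
(* For m = 0 the index falls short of n + 1, and both sides are 0. *)
have -> : (if (n + m < n.+1)%N then 0 else d^`()`_(n + m - n.+1)) = d`_m *+ m.
  case: (m) => [|m']; first by rewrite addn0 ltnSn.
  by rewrite addnS ltnS ltnNge leq_addr /= subSS addKn coef_deriv.
rewrite mulr_natl => dE.
have : d`_m *+ (n - m) == 0 by rewrite mulrnBr ?(ltnW lt_mn) // dE subrr.
rewrite mulrn_eq0 -leqn0 leqNgt subn_gt0 lt_mn /=.
by rewrite -lead_coefE lead_coef_eq0 (negPf d_neq0).
Qed.

(** * Spectra and traces of powers *)

Lemma adjmx_normal (C : numClosedFieldType) (G : sgraph) :
  adjmx C G \is normalmx.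
Proof.
apply: symmetric_normalmx.
  apply/is_hermitianmxP; rewrite expr0 scale1r map_mx_id //.
  by apply/matrixP => i j; rewrite !mxE edge_sym.
by apply/mxOverP => i j; rewrite !mxE realn.
Qed.

(** A normal matrix is unitarily diagonalisable. Similarity preserves the characteristic polynomial,
    so the diagonal is the spectrum up to order. *)
Lemma mxtrace_exp_spectrum (C : numClosedFieldType) n (A : 'M[C]_n) k :
  A \is normalmx -> \tr (A ^+ k) = \sum_(a <- spectrum A) a ^+ k.
Proof.
move=> /orthomx_spectralP; set P := spectralmx A; set d := spectral_diag A.
have P_unit : P \in unitmx := spectral_unit A.
move=> defA.
have charA : char_poly A =
    \prod_(a <- [seq d 0 i | i <- enum 'I_n]) ('X - a%:P).
  rewrite big_map big_enum /=.
  have <- : char_poly (diag_mx d) = \prod_i ('X - (d 0 i)%:P).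
    rewrite (char_poly_trig (diag_mx_is_trig d)); apply: eq_bigr => i _.
    by rewrite mxE eqxx mulr1n.
  rewrite /char_poly.
  have -> : char_poly_mx A =
      map_mx polyC (invmx P) *m char_poly_mx (diag_mx d) *m map_mx polyC P.
    rewrite mulmxBr mulmxBl -!map_mxM -defA scalar_mxC -mulmxA -map_mxM.
    by rewrite mulVmx // map_mx1 mulmx1.
  rewrite !det_mulmx mulrAC -det_mulmx -map_mxM mulVmx //.
  by rewrite map_mx1 det1 mul1r.
have defAk : A ^+ k = invmx P *m diag_mx (\row_i d 0 i ^+ k) *m P.
  elim: k => [|k IHk].
    have -> : \row_i d 0 i ^+ 0 = const_mx 1 by apply/rowP => i; rewrite !mxE.
    by rewrite expr0 diag_const_mx mulmx1 mulVmx.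
  rewrite exprS IHk {1}defA -mulmxE !mulmxA mulmxK // -(mulmxA _ (diag_mx d)).
  rewrite mulmx_diag; congr (_ *m diag_mx _ *m _).
  by apply/rowP => i; rewrite !mxE exprS.
rewrite defAk -mulmxA mxtrace_mulC -mulmxA mulmxV // mulmx1 mxtrace_diag.
rewrite (perm_big [seq d 0 i | i <- enum 'I_n]) /=; last first.
  by apply: prod_XsubC_eq; rewrite -spectrumE charA.
by rewrite big_map big_enum /=; apply: eq_bigr => i _; rewrite mxE.
Qed.

Lemma size_spectrum (C : numClosedFieldType) n (A : 'M[C]_n) :
  size (spectrum A) = n.
Proof.
by have := size_char_poly A; rewrite spectrumE size_prod_XsubC => -[].
Qed.

(** The equality [n = n'] fixes the number of eigenvalues: power sums of positive exponent do not
    see the multiplicity of 0. *)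
Lemma cospectralP (C : numClosedFieldType) n n' (A : 'M[C]_n) (A' : 'M[C]_n') :
  n = n' -> A \is normalmx -> A' \is normalmx ->
  perm_eq (spectrum A) (spectrum A') <->
  forall k, (1 <= k <= n)%N -> \tr (A ^+ k) = \tr (A' ^+ k).
Proof.
move=> eq_n nA nA'; split=> [eqAA' k _ | eq_tr].
  by rewrite !mxtrace_exp_spectrum //; apply: perm_big.
apply: perm_eq_power_sums; rewrite !size_spectrum // => k le_kn.
by rewrite -!mxtrace_exp_spectrum // eq_tr.
Qed.

(** * Totals and traces of words in A and J - I - A *)

(** This is 1^T X 1, the sum of the entries, written as a trace so that cyclicity applies. *)
Definition mxtotal (R : comPzRingType) n (X : 'M[R]_n) : R :=
  \tr (const_mx 1 *m X).

Lemma mxtotal_mulJ (R : comPzRingType) n (X Y : 'M[R]_n) :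
  mxtotal (X *m const_mx 1 *m Y) = mxtotal X * mxtotal Y.
Proof.
have JXJ : const_mx 1 *m X *m const_mx 1 = mxtotal X *: const_mx 1 :> 'M_n.
  apply/matrixP => i j; rewrite !mxE mulr1 /mxtotal /mxtrace.
  apply: eq_bigr => q _; rewrite !mxE mulr1.
  by apply: eq_bigr => p _; rewrite !mxE.
by rewrite /mxtotal !mulmxA JXJ -scalemxAl mxtraceZ.
Qed.

(* Satisfied by a m j = mxtotal (B ^+ m *m A ^+ j) and
   t m j = \tr (B ^+ m *m A ^+ j) with B = comx A. If all values of a of total degree below K agree, then
   a m j - a' m j = (-1)^m (a 0 K - a' 0 K) in degree K, and the differences of
   the t m j with m + j = K + 1 are multiples of it; t (K + 1) 0 = t' (K + 1) 0
   then forces a 0 K = a' 0 K. *)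
Lemma mixed_trace_recursion (R : numDomainType) (a t a' t' : nat -> nat -> R) :
  (forall m j, a m.+1 j = a m 0%N * a 0%N j - a m j - a m j.+1) ->
  (forall m j, a' m.+1 j = a' m 0%N * a' 0%N j - a' m j - a' m j.+1) ->
  (forall m j, t m.+1 j = a m j - t m j - t m j.+1) ->
  (forall m j, t' m.+1 j = a' m j - t' m j - t' m j.+1) ->
  (forall k, t k 0%N = t' k 0%N) -> (forall k, t 0%N k = t' 0%N k) ->
  forall k, a 0%N k = a' 0%N k.
Proof.
move=> aS aS' tS tS' t_k0 t_0k k.
(* The traces stay one degree ahead: [t] in degree K + 1 involves [a] only in degree K. *)
suff: forall K, (forall m j, (m + j < K)%N -> a m j = a' m j) /\
                (forall m j, (m + j <= K)%N -> t m j = t' m j).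
  by move=> /(_ k.+1)[aE _]; apply: aE.
elim=> [|K [aE tE]]; first by split=> // -[|m] [|j].
have da m j : (m + j)%N = K ->
    a m j - a' m j = (-1) ^+ m * (a 0%N K - a' 0%N K).
  elim: m j => [|m IHm] j mjK; first by rewrite mul1r -mjK.
  have lt_mjK : (m + j < K)%N by rewrite -mjK.
  have := IHm j.+1; rewrite addnS -addSn => /(_ mjK) Ea.
  rewrite aS aS' (aE m j) //.
  rewrite (aE m 0%N) ?addn0 ?(leq_ltn_trans (leq_addr j m)) //.
  rewrite (aE 0%N j) ?(leq_ltn_trans (leq_addl m j)) // exprS -mulrA -Ea.
  by ring.
have dt m j : (m + j)%N = K.+1 ->
    t m j - t' m j = - (m%:R * (-1) ^+ m * (a 0%N K - a' 0%N K)).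
  elim: m j => [|m IHm] j mjK; first by rewrite t_0k subrr !mul0r oppr0.
  have {}mjK : (m + j)%N = K by case: mjK.
  rewrite tS tS' (tE m j) ?mjK // exprS.
  have := da m j mjK; have := IHm j.+1; rewrite addnS mjK => /(_ erefl) Et Ea.
  transitivity ((a m j - a' m j) - (t m j.+1 - t' m j.+1)); first by ring.
  by rewrite Et Ea; ring.
have a0K : a 0%N K = a' 0%N K.
  apply/eqP; have /eqP := dt K.+1 0%N (addn0 _).
  rewrite t_k0 subrr eq_sym oppr_eq0 !mulf_eq0 pnatr_eq0 signr_eq0 /=.
  by rewrite subr_eq0.
split=> m j; rewrite leq_eqVlt => /predU1P[].
- by case=> /da/eqP; rewrite a0K subrr mulr0 subr_eq0 => /eqP.
- by rewrite ltnS; apply: aE.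
- by move/dt/eqP; rewrite a0K subrr mulr0 oppr0 subr_eq0 => /eqP.
- by rewrite ltnS; apply: tE.
Qed.

Definition comx (R : comPzRingType) n (A : 'M[R]_n) : 'M_n :=
  const_mx 1 - 1%:M - A.

Definition word (R : comPzRingType) n (A : 'M[R]_n) (s : seq bool) : 'M_n :=
  foldr (fun b X => (if b then A else comx A) *m X) 1%:M s.

Lemma mxtotalB (R : comPzRingType) n (X Y : 'M[R]_n) :
  mxtotal (X - Y) = mxtotal X - mxtotal Y.
Proof. by rewrite /mxtotal mulmxBr linearB. Qed.

Lemma mul_comx (R : comPzRingType) n (A X Y : 'M[R]_n) :
  X *m comx A *m Y = X *m const_mx 1 *m Y - X *m Y - X *m A *m Y.
Proof. by rewrite !mulmxBr !mulmxBl mulmx1. Qed.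

Lemma word_nseq (R : comPzRingType) n (A : 'M[R]_n) b k :
  word A (nseq k b) = (if b then A else comx A) ^+ k.
Proof. by elim: k => [|k IHk] //=; rewrite IHk exprS mulmxE. Qed.

Lemma word_cat (R : comPzRingType) n (A : 'M[R]_n) s1 s2 :
  word A (s1 ++ s2) = word A s1 *m word A s2.
Proof. by elim: s1 => [|b s1 IHs] /=; rewrite ?mul1mx // IHs mulmxA. Qed.

(** The power in front is an accumulator for the induction: a letter A joins it, while a letter J -
    I - A yields a product of two totals, a shorter word and a higher power. *)
Lemma mxtotal_word (R : comPzRingType) n n' (A : 'M[R]_n) (A' : 'M[R]_n') :
  (forall k, mxtotal (A ^+ k) = mxtotal (A' ^+ k)) ->
  forall s k, mxtotal (A ^+ k *m word A s) = mxtotal (A' ^+ k *m word A' s).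
Proof.
move=> eq_tot; elim=> [|[] s IHs] k /=; first by rewrite !mulmx1.
  by rewrite !mulmxA !mulmxE -!exprSr -!mulmxE IHs.
rewrite !mulmxA !mul_comx !mxtotalB !mxtotal_mulJ eq_tot IHs.
have := IHs 0%N; rewrite !expr0 !mul1mx => ->.
by rewrite !mulmxE -!exprSr -!mulmxE IHs.
Qed.

(** The same accumulator works for traces; in the J term, cyclicity moves A^k behind the word, which
    leaves a total covered by [mxtotal_word]. *)
Lemma mxtrace_word (R : comPzRingType) n n' (A : 'M[R]_n) (A' : 'M[R]_n') :
  (forall k, mxtotal (A ^+ k) = mxtotal (A' ^+ k)) ->
  (forall k, \tr (A ^+ k) = \tr (A' ^+ k)) ->
  forall s, \tr (word A s) = \tr (word A' s).
Proof.
move=> eq_tot eq_tr s.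
suff /(_ 0%N) : forall k, \tr (A ^+ k *m word A s) = \tr (A' ^+ k *m word A' s).
  by rewrite !expr0 !mul1mx.
elim: s => [|[] s IHs] k /=; first by rewrite !mulmx1.
  by rewrite !mulmxA !mulmxE -!exprSr -!mulmxE IHs.
have trJ m (B : 'M[R]_m) :
    \tr (B ^+ k *m const_mx 1 *m word B s) =
    mxtotal (word B (s ++ nseq k true)).
  by rewrite word_cat word_nseq /mxtotal -mulmxA mxtrace_mulC mulmxA.
rewrite !mulmxA !mul_comx !linearB /= !trJ IHs.
have := mxtotal_word eq_tot (s ++ nseq k true) 0%N.
rewrite !expr0 !mul1mx => ->.
by rewrite !mulmxE -!exprSr -!mulmxE IHs.
Qed.

(** The two hypotheses are the boundary cases j = 0 and m = 0 of the mixed traces in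
    [mixed_trace_recursion]. *)
Lemma mxtotal_exp_eq (R : numDomainType) n n' (A : 'M[R]_n) (A' : 'M[R]_n') :
  (forall k, \tr (A ^+ k) = \tr (A' ^+ k)) ->
  (forall k, \tr (comx A ^+ k) = \tr (comx A' ^+ k)) ->
  forall k, mxtotal (A ^+ k) = mxtotal (A' ^+ k).
Proof.
move=> eq_trA eq_trB k.
pose a p (B : 'M[R]_p) m j := mxtotal (comx B ^+ m *m B ^+ j).
pose t p (B : 'M[R]_p) m j := \tr (comx B ^+ m *m B ^+ j).
have aS p (B : 'M_p) m j :
    a p B m.+1 j = a p B m 0%N * a p B 0%N j - a p B m j - a p B m j.+1.
  rewrite /a exprSr -mulmxE mul_comx !mxtotalB mxtotal_mulJ !expr0 mulmx1 mul1mx.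
  by rewrite exprS -mulmxE mulmxA.
have tS p (B : 'M_p) m j :
    t p B m.+1 j = a p B m j - t p B m j - t p B m j.+1.
  rewrite /t /a exprS -mulmxE -mulmxA -[comx B]mul1mx mul_comx mul1mx !linearB /=.
  rewrite !mul1mx; congr (_ - _ - _).
  (* [B] and [comx B] need not commute; cyclicity of the trace brings the leading [B] to the end. *)
  by rewrite mxtrace_mulC exprSr -mulmxE mulmxA.
have := mixed_trace_recursion (aS _ A) (aS _ A') (tS _ A) (tS _ A').
have t_k0 i : t _ A i 0%N = t _ A' i 0%N by rewrite /t !expr0 !mulmx1.
have t_0k i : t _ A 0%N i = t _ A' 0%N i by rewrite /t !expr0 !mul1mx.
by move=> /(_ t_k0 t_0k k); rewrite /a !expr0 !mul1mx.
Qed.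

(** * Closed walks as traces of words *)

(** An entry of the word matrix, as a sum of 0/1 weights with both endpoints fixed; the product form
    lets the first step factor out. *)
Definition walk_sum (R : comNzRingType) (G : sgraph) k (beta : k.-tuple bool)
    (x y : G) : R :=
  \sum_(w : {ffun 'I_k.+1 -> G} | (w ord0 == x) && (w ord_max == y))
     \prod_(i < k)
       (step (tnth beta i) (w (widen_ord (leqnSn k) i)) (w (lift ord0 i)))%:R.

Lemma walk_sum_cons (R : comNzRingType) (G : sgraph) k b
    (beta : k.-tuple bool) (x y : G) :
  walk_sum R [tuple of b :: beta] x y =
  \sum_z (step b x z)%:R * walk_sum R beta z y.
Proof.
pose ffcons (w : {ffun 'I_k.+1 -> G}) : {ffun 'I_k.+2 -> G} :=
  [ffun i => if unlift ord0 i is Some j then w j else x].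
pose fftail (w : {ffun 'I_k.+2 -> G}) : {ffun 'I_k.+1 -> G} :=
  [ffun i => w (lift ord0 i)].
have ffconsK w : fftail (ffcons w) = w.
  by apply/ffunP => i; rewrite !ffunE liftK.
(* [ffcons] restores a walk from its tail only if it starts at x, as the range of summation
   ensures. *)
rewrite {1}/walk_sum (reindex_onto ffcons fftail); last first.
  move=> w /andP[/eqP w0 _]; apply/ffunP => i; rewrite !ffunE.
  by case: unliftP => [j ->|->]; rewrite ?ffunE.
rewrite (partition_big (fun w : {ffun 'I_k.+1 -> G} => w ord0) predT) //=.
apply: eq_bigr => z _; rewrite big_distrr /=.
apply: eq_big => [w|w /andP[_ /eqP w0]].
  rewrite ffconsK eqxx andbT !ffunE unlift_none eqxx /=.
  have -> : ord_max = lift ord0 (@ord_max k) by apply: val_inj.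
  by rewrite liftK andbC.
rewrite big_ord_recl; congr (_ * _).
  have -> : widen_ord (leqnSn k.+1) ord0 = ord0 by apply: val_inj.
  by rewrite tnth0 !ffunE unlift_none liftK w0.
apply: eq_bigr => i _.
have -> : widen_ord (leqnSn k.+1) (lift ord0 i) =
           lift ord0 (widen_ord (leqnSn k) i).
  by apply: val_inj.
by rewrite tnthS !ffunE !liftK.
Qed.

Lemma nwalk_walk_sum (R : comNzRingType) (G : sgraph) k (beta : k.-tuple bool) :
  (nwalk G beta)%:R = \sum_(x : G) walk_sum R beta x x.
Proof.
rewrite /nwalk cardsE -sum1_card natr_sum.
rewrite (partition_big (fun w : {ffun 'I_k.+1 -> G} => w ord0) predT) //=.
apply: eq_bigr => x _.
rewrite /walk_sum big_mkcond [RHS]big_mkcond; apply: eq_bigr => w _.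
rewrite unfold_in /closed_walk.
have [<-|] := eqVneq (w ord0) x; rewrite ?andbF //= andbT.
case: eqP => //= _.
have natrM_and : {morph (fun b : bool => b%:R : R) : b c / b && c >-> b * c}.
  by move=> [] c; rewrite ?mul1r ?mul0r.
have true1 : true%:R = 1 :> R by [].
rewrite -(big_morph _ natrM_and true1) big_andE.
by case: [forall i, _].
Qed.

Lemma comx_adjmx (C : numClosedFieldType) (G : sgraph) :
  comx (adjmx C G) = adjmx C (compl G).
Proof.
apply/matrixP => i j; rewrite !mxE /= /co_edge /= (inj_eq enum_val_inj).
have [<-|_] := eqVneq i j; first by rewrite edge_irr subrr subr0.
by rewrite subr0; case: edge; rewrite ?subrr ?subr0.
Qed.

Lemma mxtrace_nwalk (C : numClosedFieldType) (G : sgraph) k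
    (beta : k.-tuple bool) :
  \tr (word (adjmx C G) beta) = (nwalk G beta)%:R.
Proof.
have wordE : forall i j, word (adjmx C G) beta i j =
    walk_sum C beta (enum_val i) (enum_val j).
  elim: k beta => [|k IHk] beta i j.
    rewrite tuple0 /= mxE /walk_sum.
    (* A walk of length 0 is a single vertex, so the sum is an entry of the identity matrix. *)
    have -> : ord_max = ord0 :> 'I_1 by apply: val_inj.
    have [<-|ne_ij] := eqVneq i j.
      rewrite (big_pred1 [ffun=> enum_val i]) ?big_ord0 // => w /=.
      rewrite andbb; apply/eqP/eqP => [w0|->]; last by rewrite ffunE.
      by apply/ffunP => l; rewrite ffunE ord1.
    rewrite big_pred0 // => w; apply/negP => /andP[/eqP -> /eqP/enum_val_inj].
    exact/eqP.
  have [b [{}beta ->]] : exists b (beta' : k.-tuple bool),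
      beta = [tuple of b :: beta'].
    by exists (thead beta), [tuple of behead beta]; apply: tuple_eta.
  rewrite walk_sum_cons /= mxE.
  rewrite [RHS](reindex (enum_val : 'I_#|G| -> G)) /=; last first.
    exact/onW_bij/enum_val_bij.
  apply: eq_bigr => z _; rewrite IHk; congr (_ * _).
  by case: b; rewrite ?comx_adjmx mxE.
rewrite nwalk_walk_sum (reindex (enum_val : 'I_#|G| -> G)) /=; last first.
  exact/onW_bij/enum_val_bij.
by apply: eq_bigr => i _; rewrite wordE.
Qed.

Theorem lemma2p2 (C : numClosedFieldType) (n : nat) (G H : sgraph)
    (hG : #|G| = n) (hH : #|H| = n) :
  (gen_cospectral C G H <->
   forall (k : nat) (beta : k.-tuple bool), (1 <= k)%N ->
     nwalk G beta = nwalk H beta)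
  /\
  (gen_cospectral C G H <->
   forall (k : nat) (beta : k.-tuple bool), (1 <= k <= n)%N ->
     beta = ones k \/ beta = zeros k ->
     nwalk G beta = nwalk H beta).
Proof.
subst n.
have nwalkE k (beta : k.-tuple bool) : nwalk G beta = nwalk H beta <->
    \tr (word (adjmx C G) beta) = \tr (word (adjmx C H) beta).
  by rewrite !mxtrace_nwalk; split=> [-> // | /eqP]; rewrite eqr_nat => /eqP.
have iii_i : (forall (k : nat) (beta : k.-tuple bool), (1 <= k <= #|G|)%N ->
     beta = ones k \/ beta = zeros k -> nwalk G beta = nwalk H beta) ->
   gen_cospectral C G H.
  (* Constant words are powers of the two adjacency matrices, so [cospectralP] applies to each graph
     pair. *)
  move=> eq_nw; split; apply/cospectralP; rewrite ?adjmx_normal //.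
    move=> k le_kn; have /nwalkE := eq_nw k _ le_kn (or_introl erefl).
    by rewrite !word_nseq.
  move=> k le_kn; have /nwalkE := eq_nw k _ le_kn (or_intror erefl).
  by rewrite !word_nseq !comx_adjmx.
have i_ii : gen_cospectral C G H -> forall (k : nat) (beta : k.-tuple bool),
    nwalk G beta = nwalk H beta.
  case=> cosp cosp_co k beta; apply/nwalkE.
  have eq_trA i : \tr (adjmx C G ^+ i) = \tr (adjmx C H ^+ i).
    by rewrite !mxtrace_exp_spectrum ?adjmx_normal //; apply: perm_big.
  apply: mxtrace_word => //; apply: mxtotal_exp_eq => // i.
  rewrite !comx_adjmx !mxtrace_exp_spectrum; first exact: perm_big.
    exact: (adjmx_normal C (compl H)).
  exact: (adjmx_normal C (compl G)).
split; split=> [cosp k beta *|eq_nw]; try exact: i_ii.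
  (* (ii) gives (i) by restriction to the constant vectors of (iii). *)
  by apply: iii_i => k beta /andP[k_gt0 _] _; apply: eq_nw.
exact: iii_i.
Qed.
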